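(* Let $F \stackrel{\mathrm{loc}}{\ll} G$ and $M := \mathcal{M}^G F$. Suppose that $\Delta G(t_G) = 0$. Then the following are equivalent: (a) $M$ is an $H^1$-martingale on $[0, t_G]$ (in the sense that there exists a filtration $\mathbb{F}=(\mathcal{F}_t)_{t\in[0,\infty]}$ of $\mathcal{F}$ such that $M$ is an $H^1$-$\mathbb{F}$-martingale on $[0,t_G]$). (b) $M$ is an $H^1$-$\mathbb{F}^\gamma$-martingale on $[0, t_G]$. (c) $F(\cdot-) \in L^1(\mathrm{d}G)$ and $\mathcal{A}^G F \in L^1(\mathrm{d}G)$.
   Context: Analytic setting. Fix a distribution function $G:\mathbb{R}\to[0,1]$ (nondecreasing, right-continuous) with $G(0)=0$ and $\lim_{t\to\infty}G(t)=1$; set $G(\infty):=1$. Put $t_G:=\sup\{t\ge 0: G(t)<1\}\in(0,\infty]$, $\overline{G}:=1-G$, $\Delta G(t_G):=G(t_G)-\lim_{t\uparrow\uparrow t_G}G(t)$ (so $\Delta G(t_G)=0$ if $t_G=\infty$). The notation $t\uparrow\uparrow t_G$ means $t\to t_G$ with $t<t_G$, and $F(v-)$ is the left limit of $F$ at $v$; $F(\cdot-)$ is the function $v\mapsto F(v-)$. $\mathrm{d}G$ is the Lebesgue--Stieltjes measure on $(0,\infty)$ induced by $G$. Since $\mathrm{d}G$ is concentrated on $(0,t_G]$ and a possible atom at $t_G$ does not affect integrability, a Borel function $\phi$ belongs to $L^1(\mathrm{d}G)$ iff $\int_{(0,t_G)}|\phi|\,\mathrm{d}G<\infty$ (functions only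 defined on $(0,t_G)$ are understood this way). A Borel function $F:[0,\infty)\to\mathbb{R}$ satisfies $F\stackrel{\mathrm{loc}}{\ll}G$ if for every $0<b<t_G$ there is a $\mathrm{d}G$-integrable $f:(0,b]\to\mathbb{R}$ with $F(t)-F(0)=\int_{(0,t]}f(v)\,\mathrm{d}G(v)$ for all $t\in(0,b]$. Then there is a Borel function $\frac{\mathrm{d}F}{\mathrm{d}G}:(0,\infty)\to\mathbb{R}$ (local density), $\mathrm{d}G$-a.e. unique on $(0,t_G)$, which serves as such an $f$ for every $b\in(0,t_G)$; moreover $F$ is càdlàg on $[0,t_G)$. Define $\mathcal{A}^G F:(0,\infty)\to\mathbb{R}$ by $\mathcal{A}^G F(v)=F(v-)-\frac{\mathrm{d}F}{\mathrm{d}G}(v)\overline{G}(v)$ for $v\in(0,t_G)$; for $v\ge t_G$, $\mathcal{A}^G F(v)=F(t_G-)\mathbf{1}_{\{\Delta G(t_G)>0\}}$ if $F(t_G-):=\lim_{t\uparrow\uparrow t_G}F(t)$ exists in $\mathbb{R}$, and $\mathcal{A}^G F(v)=0$ otherwise. Probabilistic setting. $(\Omega,\mathcal{F},P)$ is a probability space and $\gamma$ a $(0,\infty)$-valued random variable with distribution function $G$. $\mathbb{F}^\gamma=(\mathcal{F}^\gamma_t)_{t\in[0,\infty]}$ is the filtration $\mathcal{F}^\gamma_t=\sigma(\{\gamma\le s\}:s\in(0,t])$. The process $\mathcal{M}^G F=(\mathcal{M}^G_t F)_{t\in[0,\infty]}$ is $\mathcal{M}^G_tF=F(t)\mathbf{1}_{\{t<\gamma\}}+\mathcal{A}^G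 F(\gamma)\mathbf{1}_{\{t\ge\gamma\}}$. Filtrations are indexed by $[0,\infty]$ and are not assumed to satisfy the usual conditions. Martingale terminology, for an interval $I=[0,T]$ with $T\in(0,\infty]$ and a filtration $\mathbb{F}$: a process $X$ is an $\mathbb{F}$-martingale on $I$ if $P$-a.e. path is càdlàg on $I$, $X$ is $\mathbb{F}$-adapted on $I$, $E[|X_t|]<\infty$ for all $t\in I$, and $E[X_t|\mathcal{F}_s]=X_s$ a.s. for all $s\le t$ in $I$. It is an $H^1$-$\mathbb{F}$-martingale on $I$ if in addition $E[\sup_{t\in I}|X_t|]<\infty$. *)

(* Defs.v *)
From HB Require Import structures.
From mathcomp Require Import all_boot all_order all_algebra.
From mathcomp Require Import all_classical all_reals all_analysis.
From mathcomp Require Import measurable_realfun lra.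
Set Implicit Arguments.
Unset Strict Implicit.
Unset Printing Implicit Defensive.
Import Order.TTheory GRing.Theory Num.Theory.
Import numFieldNormedType.Exports.
Local Open Scope classical_set_scope.
Local Open Scope ring_scope.

Section Analytic.
Context {R : realType}.

Definition left_nbhs (t : \bar R) : set_system R :=
  match t with
  | r%:E => r^'-
  | +oo%E => +oo
  | -oo%E => -oo
  end.

(* [lim] is a junk value when the limit does not exist *)
Definition left_lim (F : R -> R) (t : \bar R) : R :=
  lim (F s @[s --> left_nbhs t]).

Variable G : cumulativeBounded (0 : R) (1 : R).

Definition dG : set (measurableTypeR R) -> \bar R :=
  lebesgue_stieltjes_measure G.

HB.instance Definition _ := SigmaFiniteMeasure.on dG.

Definition t_G : \bar R := ereal_sup [set t%:E | t in [set t : R | 0 <= t /\ G t < 1]].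

Definition G_ext (t : \bar R) : R :=
  match t with
  | r%:E => G r
  | +oo%E => 1
  | -oo%E => 0
  end.

Definition jump_tG : R := G_ext t_G - left_lim G t_G.

Definition itv_tG : set R := [set v | 0 < v /\ (v%:E < t_G)%E].

Definition L1_dG (phi : R -> R) : Prop := dG.-integrable itv_tG (EFin \o phi).

(* Functions on [0, oo[ (resp. ]0, oo[) are total functions whose values
   outside of that interval are irrelevant. *)
Definition density_on (F : R -> R) (b : R) (f : R -> R) : Prop :=
  dG.-integrable `]0, b] (EFin \o f) /\
  forall t : R, 0 < t <= b -> F t - F 0 = \int[dG]_(v in `]0, t]) f v.

Definition loc_abs_cont (F : R -> R) : Prop :=
  measurable_fun (`[0, +oo[ : set R) F /\
  forall b : R, 0 < b -> (b%:E < t_G)%E -> exists f, density_on F b f.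

Definition local_density (F f : R -> R) : Prop :=
  measurable_fun (`]0, +oo[ : set R) f /\
  forall b : R, 0 < b -> (b%:E < t_G)%E -> density_on F b f.

Lemma integrable_setU (d : measure_display) (T : measurableType d)
    (mu : {measure set T -> \bar R}) (A B : set T) (u : T -> \bar R) :
  measurable A -> measurable B -> [disjoint A & B] ->
  mu.-integrable A u -> mu.-integrable B u -> mu.-integrable (A `|` B) u.
Proof.
move=> mA mB dAB /integrableP[muA uA] /integrableP[muB uB].
have mU : measurable_fun (A `|` B) u by exact/measurable_funU.
apply/integrableP; split=> //.
rewrite ge0_integral_setU//; last exact: measurableT_comp.
by rewrite lte_add_pinfty.
Qed.

Lemma density_paste (F g h : R -> R) (a b : R) : 0 < a -> a <= b ->
  density_on F a g -> density_on F b h ->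
  density_on F b (fun v => if v <= a then g v else h v).
Proof.
move=> a0 ab [ig eg] [ih eh]; set k := fun v => _.
have kg t : t <= a -> {in `]0, t]%classic, k =1 g}.
  by move=> ta v; rewrite inE/= in_itv/= => /andP[_ vt]; rewrite /k (le_trans vt ta).
have kh t : {in `]a, t]%classic, k =1 h}.
  by move=> v; rewrite inE/= in_itv/= => /andP[va _]; rewrite /k leNgt va.
have split_itv t : a <= t -> `]0, t]%classic = `]0, a] `|` `]a, t] :> set R.
  by move=> at_; rewrite -itv_bndbnd_setU// bnd_simp// ltW.
have dis t : [disjoint `]0, a]%classic & `]a, t]%classic : set R].
  apply/disj_setPS => v [] /=; rewrite !in_itv/= => /andP[_ va] /andP[+ _].
  by rewrite ltNge va.
have ig1 : dG.-integrable `]0, a] (EFin \o k).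
  by apply: (eq_integrable _ _ _ _ ig) => // v va /=; rewrite (kg _ (lexx a)).
have ih1 : dG.-integrable `]a, b] (EFin \o k).
  have : dG.-integrable `]a, b] (EFin \o h).
    apply: integrableS ih => //.
    by apply: subset_itvr; rewrite bnd_simp ltW.
  by apply: eq_integrable => // v va /=; rewrite (kh b).
have ik : dG.-integrable `]0, b] (EFin \o k).
  by rewrite split_itv//; exact: integrable_setU.
split=> // t /andP[t0 tb].
have [ta|at_] := leP t a.
  have -> : \int[dG]_(v in `]0, t]) k v = \int[dG]_(v in `]0, t]) g v.
    exact/eq_Rintegral/kg.
  by rewrite -eg// t0.
have iS u : dG.-integrable `]0, b] (EFin \o u) ->
    dG.-integrable (`]0, a] `|` `]a, t]) (EFin \o u).
  move=> iu; rewrite -split_itv ?ltW//; apply: integrableS iu => //.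
  by apply: subset_itvl; rewrite bnd_simp.
rewrite split_itv ?ltW// Rintegral_setU//; last exact: iS.
have -> : \int[dG]_(v in `]0, a]) k v = \int[dG]_(v in `]0, a]) g v.
  exact/eq_Rintegral/kg.
have -> : \int[dG]_(v in `]a, t]) k v = \int[dG]_(v in `]a, t]) h v.
  exact/eq_Rintegral/kh.
rewrite -eg ?a0 ?lexx//.
have := eh t; rewrite t0 tb => /(_ isT).
rewrite split_itv ?ltW// Rintegral_setU//; last exact: iS.
rewrite -eh ?a0//= => eht; lra.
Qed.

Lemma cofinal_tG : (0 < t_G)%E -> exists b : nat -> R,
  [/\ forall n, 0 < b n, forall n, b n <= b n.+1,
      forall n, ((b n)%:E < t_G)%E &
      forall v : R, (v%:E < t_G)%E -> exists n, v <= b n].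
Proof.
case: t_G => [r| |]//; rewrite ?lte_fin => r0.
  exists (fun n => r - r / n.+2%:R); split=> [n|n|n|v].
  - by rewrite subr_gt0 ltr_pdivrMr// ltr_pMr// ltr1n.
  - by rewrite lerD2l lerN2 ler_pM2l// lef_pV2 ?posrE// ler_nat.
  - by rewrite lte_fin gtrBl divr_gt0.
  - rewrite lte_fin -subr_gt0 => vr.
    exists (Num.bound (r / (r - v))).
    rewrite lerBrDr -lerBrDl ler_pdivrMr// mulrC -ler_pdivrMr//.
    apply: (le_trans (ltW (archi_boundP _))); first by rewrite divr_ge0// ltW.
    by rewrite ler_nat -addn2 leq_addr.
exists (fun n => n.+1%:R); split=> [//|n|n|v _].
- by rewrite ler_nat.
- by rewrite ltry.
- exists (Num.bound `|v|); apply: (le_trans (ler_norm v)).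
  by apply: (le_trans (ltW (archi_boundP _))) => //; rewrite ler_nat.
Qed.

(* A locally absolutely continuous function always has a local density, so that
   quantifying over all of its local densities is not vacuous. *)
Lemma local_density_exists (F : R -> R) :
  loc_abs_cont F -> exists f, local_density F f.
Proof.
move=> [_ Fac]; have [t0|t0] := leP t_G 0%E.
  exists (cst 0); split=> // b b0 bt; exfalso.
  by have := lt_le_trans bt t0; rewrite lte_fin ltNge ltW.
have [b [b0 bS bt bcof]] := cofinal_tG t0.
have /choice[h hP] : forall n, exists f, density_on F (b n) f.
  by move=> n; exact: Fac.
have bnd m n : (m <= n)%N -> b m <= b n.
  by apply: (homo_leq (f := b) (r := fun x y => x <= y)) => //; exact: le_trans.
pose g := fix g n := if n is m.+1 then
  fun v => if v <= b m then g m v else h n v else h 0%N.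
have gP n : density_on F (b n) (g n).
  by elim: n => [|n IH]; [exact: hP | exact: density_paste].
have gE m n v : (m <= n)%N -> v <= b m -> g n v = g m v.
  move=> mn vm; elim: n mn => [|n IH]; first by rewrite leqn0 => /eqP->.
  rewrite leq_eqVlt ltnS => /predU1P[->//|mn] /=.
  by rewrite (le_trans vm (bnd _ _ mn)) IH.
pose f v := if pselect (exists n, 0 < v <= b n) is left e
  then g (projT1 (cid e)) v else 0.
have fE n v : 0 < v -> v <= b n -> f v = g n v.
  move=> v0 vn; rewrite /f; case: pselect => [e|[]]; last first.
    by exists n; rewrite v0.
  case: cid => m /= /andP[_ vm].
  by have [mn|/ltnW nm] := leqP m n; [rewrite (gE m n) | rewrite (gE n m)].
exists f; split.
  apply: (@measurable_fun_cvg _ _ _ _ (fun n => g n \_ `]0, b n])) => [n|v].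
    apply: measurable_funTS; apply/(measurable_restrictT (g n)) => //.
    have [ign _] := gP n.
    by apply/measurable_EFinP; have /integrableP[] := ign.
  rewrite /= in_itv/= andbT => v0; apply: cvg_near_cst.
  have [[n vn]|nv] := pselect (exists n, v <= b n).
    near=> m; have nm : (n <= m)%N by near: m; exact: nbhs_infty_ge.
    rewrite /patch mem_set/= ?in_itv/= ?v0 ?(le_trans vn (bnd _ _ nm))//.
    by rewrite (fE m)// (le_trans vn (bnd _ _ nm)).
  near=> m; rewrite /patch memNset/=; last first.
    by move=> /itvP vm; apply: nv; exists m; rewrite vm.
  by rewrite /f; case: pselect => // e; case: nv; case: e => n /andP[_ vn]; exists n.
move=> c c0 /[dup] ct /bcof[n cn].
have [ig eg] := gP n.
have fgE t : t <= c -> {in `]0, t]%classic, g n =1 f}.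
  move=> tc v; rewrite inE/= in_itv/= => /andP[v0 vt].
  by rewrite (fE n)// (le_trans vt (le_trans tc cn)).
split.
  have : dG.-integrable `]0, c] (EFin \o g n).
    apply: integrableS ig => //.
    by apply: subset_itvl; rewrite bnd_simp.
  by apply: eq_integrable => // v vc /=; rewrite (fgE c).
move=> t /andP[t0' tc]; rewrite eg ?t0' ?(le_trans tc cn)//.
exact/eq_Rintegral/fgE.
Unshelve. all: by end_near. Qed.

(* [f] stands for the local density dF/dG *)
Definition calA (F f : R -> R) (v : R) : R :=
  if (v%:E < t_G)%E then left_lim F v%:E - f v * (1 - G v)
  else if `[< cvg (F s @[s --> left_nbhs t_G]) >]
       then left_lim F t_G * (0 < jump_tG)%R%:R
       else 0.

End Analytic.

Section Martingale.
Context {R : realType} {d : measure_display} {Omega : measurableType d}.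
Variable P : probability Omega R.

(* Time indices range over [0, oo], encoded as the nonnegative part of
   [\bar R]; values at negative times are irrelevant. *)
Implicit Types (X : \bar R -> Omega -> R) (FF : \bar R -> set (set Omega)).

Definition filtration FF : Prop :=
  [/\ forall t, (0 <= t)%E -> sigma_algebra setT (FF t),
      forall t, (0 <= t)%E -> FF t `<=` measurable &
      forall s t, (0 <= s)%E -> (s <= t)%E -> FF s `<=` FF t].

Definition measurable_wrt (H : set (set Omega)) (Y : Omega -> R) : Prop :=
  forall B, measurable B -> H (Y @^-1` B).

(* Y is a version of E[Z | H] *)
Definition cond_expectation (H : set (set Omega)) (Z Y : Omega -> R) : Prop :=
  [/\ measurable_wrt H Y,
      P.-integrable setT (EFin \o Y) &
      forall A, H A -> \int[P]_(w in A) Z w = \int[P]_(w in A) Y w].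

Definition cadlag_on (T : \bar R) (x : \bar R -> R) : Prop :=
  (forall t, (0 <= t)%E -> (t < T)%E ->
    x s @[s --> within [set s | (t < s)%E] (nbhs t)] --> x t) /\
  (forall t, (0 < t)%E -> (t <= T)%E ->
    cvg (x s @[s --> within [set s | (s < t)%E] (nbhs t)])).

Definition martingale_on (T : \bar R) FF X : Prop :=
  [/\ {ae P, forall w, cadlag_on T (X ^~ w)},
      forall t, (0 <= t)%E -> (t <= T)%E -> measurable_wrt (FF t) (X t),
      forall t, (0 <= t)%E -> (t <= T)%E -> P.-integrable setT (EFin \o X t) &
      forall s t, (0 <= s)%E -> (s <= t)%E -> (t <= T)%E ->
        exists2 Y, cond_expectation (FF s) (X t) Y & {ae P, forall w, Y w = X s w}].

(* The integrand need not be measurable, but as almost every path is cadlag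
   it is a.e. equal to a measurable function, so that the integral (a supremum
   over simple functions below the integrand) is the usual expectation. *)
Definition H1_martingale_on (T : \bar R) FF X : Prop :=
  martingale_on T FF X /\
  (\int[P]_w ereal_sup [set `|X t w|%:E | t in [set t | (0 <= t <= T)%E]] < +oo)%E.

Definition filtration_gamma (gamma : Omega -> R) (t : \bar R) : set (set Omega) :=
  <<s [set A | exists2 s : \bar R, (0 < s <= t)%E &
                 A = [set w | ((gamma w)%:E <= s)%E]] >>.

Definition calM (G : cumulativeBounded (0 : R) (1 : R)) (F f : R -> R)
    (gamma : Omega -> R) (t : \bar R) (w : Omega) : R :=
  if (t < (gamma w)%:E)%E then F (fine t) else calA G F f (gamma w).

End Martingale.

(* Main.v *)
Require Import Defs.
From HB Require Import structures.
From mathcomp Require Import all_boot all_order all_algebra.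
From mathcomp Require Import all_classical all_reals all_analysis.
From mathcomp Require Import measurable_realfun.
Set Implicit Arguments.
Unset Strict Implicit.
Unset Printing Implicit Defensive.
Import Order.TTheory GRing.Theory Num.Theory.
Import numFieldNormedType.Exports.
Local Open Scope classical_set_scope.
Local Open Scope ring_scope.

(** Write [A] for [calA G F f], [M] for [calM G F f gamma] and [F_-] for the
    left limits of [F].  As [G] does not jump at [t_G], the time [gamma] lies
    in ]0, t_G[ almost surely, so that [M] ends at [M t_G = A gamma] a.s.

    If [M] is an H^1-martingale for any filtration at all, then [A gamma] is
    integrable, and so is [F_- gamma], because
    [|F_- gamma| <= sup_(t < gamma) |F t| <= sup_t |M t|]; since [dG] is the law
    of [gamma], this is the integrability of [A] and [F_-] against [dG]
    ([H1_integrable]).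

    Conversely, let [F_-] and [A] be in L^1(dG).  Then so is their difference
    [f * (1 - G)] on ]0, t_G[.  By Fubini and [dG ]u, +oo[ = 1 - G u], for
    every [h]
      [int_v (int_(u < v) h u dG u) dG v = int_u h u * (1 - G u) dG u]
    ([integral_primitive]).  This identity is used twice.
    - With [h = |f|]: the variation [v |-> int_(]0, v[) |f| dG] is integrable;
      it dominates [sup_(t < v) |F t|] up to [|F 0|], so [sup_t |M t|] is
      integrable.
    - With [h = f] on ]s, t_G[: the inner integral is [F_- v - F s], whence
      [F s * (1 - G s) = int_(]s, t_G[) A dG] ([calA_tail_integral]).
    The second consequence says that [M s] and [A gamma] have the same integral
    over [{s < gamma}], and they coincide on [{gamma <= s}].  As [{s < gamma}] is
    an atom of the natural filtration of [gamma] at time [s], [M s] is the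
    conditional expectation of [A gamma] ([calM_closed]): [M] is a closed
    martingale. *)

(** * Measures and the distribution function *)

Section measure_facts.
Context {d : measure_display} {T : measurableType d} {R : realType}.
Variable mu : {measure set T -> \bar R}.

(** The integral of a nonnegative function is a supremum over simple functions
    below it, whence monotonicity even for the suprema of paths, which are taken
    over uncountably many times and may fail to be measurable. *)
Lemma ge0_le_integralT (f g : T -> \bar R) :
  (forall x, 0 <= f x)%E -> (forall x, f x <= g x)%E ->
  (\int[mu]_x f x <= \int[mu]_x g x)%E.
Proof.
move=> f0 fg; have g0 x : (0 <= g x)%E by exact: le_trans (fg x).
rewrite !ge0_integralTE//; apply: le_ereal_sup => _ [h hf <-].
by exists h => // x; exact: le_trans (fg x).
Qed.

(** Dominated convergence for a varying domain of integration; it turns the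
    one-sided limits of an indefinite integral into convergence of intervals. *)
Lemma Rintegral_cvg_set (E : set T) (f : T -> R) (A : nat -> set T) (B : set T) :
  measurable E -> mu.-integrable E (EFin \o f) ->
  (forall n, measurable (A n)) -> measurable B ->
  (forall n, A n `<=` E) -> B `<=` E ->
  (forall x, E x -> \forall n \near \oo, (x \in A n) = (x \in B)) ->
  \int[mu]_(x in A n) f x @[n --> \oo] --> \int[mu]_(x in B) f x.
Proof.
move=> mE fi mA mB AE BE cvgAB.
have restrE C : C `<=` E ->
    (\int[mu]_(x in C) (f x)%:E = \int[mu]_(x in E) ((f \_ C) x)%:E)%E.
  move=> CE; rewrite integral_mkcond [RHS]integral_mkcond.
  apply: eq_integral => x _; rewrite /patch; case: ifPn => xC.
    by rewrite mem_set//; apply: CE; rewrite inE in xC.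
  by case: ifP.
have mf : measurable_fun E f by apply/measurable_EFinP; case/integrableP: fi.
have mfC C : measurable C -> C `<=` E -> measurable_fun E (f \_ C).
  by move=> mC CE; apply/(measurable_restrict f mC mE); apply: measurable_funS mf => // x [].
apply: fine_cvg; rewrite fineK; last first.
  by apply: integrable_fin_num => //; exact: integrableS fi.
rewrite restrE//; under eq_fun do rewrite restrE//.
have [n|||||_ _] := @dominated_convergence _ _ _ mu E mE
  (fun n x => ((f \_ (A n)) x)%:E) (fun x => ((f \_ B) x)%:E) (fun x => `|(f x)%:E|%E).
- exact/measurable_EFinP/mfC.
- exact/measurable_EFinP/mfC.
- apply: aeW => x Ex; apply: cvg_near_cst; near=> n.
  rewrite /patch (_ : (x \in A n) = (x \in B))//; near: n; exact: cvgAB.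
- exact: (integrable_abse fi).
- by apply: aeW => x n Ex; rewrite lee_fin /patch; case: ifP => _; rewrite ?normr0.
- exact.
Unshelve. all: by end_near. Qed.

End measure_facts.

Section distribution_function.
Context {R : realType} (G : cumulativeBounded (0 : R) (1 : R)).

Lemma dG_itvNyc r : dG G `]-oo, r] = (G r)%:E.
Proof. exact: cdf_lebesgue_stieltjes_id. Qed.

Lemma dG_itvoy r : dG G `]r, +oo[ = (1 - G r)%:E.
Proof.
rewrite -setCitvl [LHS](@probability_setC _ _ _ (lebesgue_stieltjes_measure G))//.
by rewrite [X in (1 - X)%E]dG_itvNyc.
Qed.

Lemma G_le1 r : G r <= 1.
Proof. by rewrite -subr_ge0 -lee_fin -dG_itvoy measure_ge0. Qed.

(** Restates right continuity through the coercion of [cumulativeBounded], so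
    that the value at the point can be rewritten. *)
Lemma G_rcvg r : G x @[x --> r^'+] --> G r.
Proof. exact: cumulative_is_right_continuous. Qed.

Lemma tG_gt0 : G 0 = 0 -> (0 < t_G G)%E.
Proof.
move=> G0.
have : \forall t \near (0:R)^'+, G t < 1.
  have /cvgrPdist_lt /(_ 1 ltr01) := @G_rcvg 0.
  rewrite G0; apply: filterS => t; rewrite sub0r normrN; exact: le_lt_trans (ler_norm _).
move=> H; near (0:R)^'+ => t.
apply: (@lt_le_trans _ _ t%:E); first by rewrite lte_fin.
by apply: ereal_sup_ubound; exists t => //; split => //; near: t.
Unshelve. all: by end_near. Qed.

Lemma lt_tG_ex t : (t%:E < t_G G)%E -> exists2 b, t < b & (b%:E < t_G G)%E.
Proof.
case: (t_G G) => [r| |]//; rewrite ?lte_fin => tr.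
  by exists ((t + r) / 2); rewrite ?lte_fin midf_lt.
by exists (t + 1); rewrite ?ltrDl ?ltry.
Qed.

Lemma itv_tGE : itv_tG G = [set` Interval (BRight 0)
  (match t_G G with r%:E => BLeft r | +oo%E => +oo%O | -oo%E => -oo%O end)].
Proof.
rewrite /itv_tG; case: (t_G G) => [r| |]; apply/seteqP; split => v /=;
  rewrite in_itv/= ?lte_fin ?ltry ?andbT ?andbF//;
  first [by case=>->-> | by case/andP | by case | by split].
Qed.

Lemma measurable_itv_tG : measurable (itv_tG G : set (measurableTypeR R)).
Proof. by rewrite itv_tGE. Qed.

Lemma measurable_ge_tG :
  measurable ([set v | (t_G G <= v%:E)%E] : set (measurableTypeR R)).
Proof.
rewrite (_ : mkset _ = ~` [set v | (v%:E < t_G G)%E]); last first.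
  by apply/seteqP; split => v /=; rewrite leNgt => /negP.
apply: measurableC; rewrite -[mkset _]setTI.
apply: (@emeasurable_fun_infty_o _ _ _ setT EFin) => //.
Qed.

(** For finite [t_G], right continuity and the definition of [t_G] as a supremum
    give [G t_G = 1]; without a jump, [G] then tends to 1 on the left of [t_G],
    and the tails [dG ]t, +oo[ = 1 - G t] shrink to 0. *)
Lemma dG_ge_tG : G 0 = 0 -> jump_tG G = 0 -> dG G [set v | (t_G G <= v%:E)%E] = 0%E.
Proof.
move=> G0 jump0; have := tG_gt0 G0; move: jump0; rewrite /jump_tG.
case E : (t_G G) => [r| |]//=; last first.
  move=> _ _; rewrite (_ : mkset _ = set0) ?measure0//.
  by rewrite -subset0 => v/=; rewrite leye_eq.
move=> /eqP; rewrite subr_eq0 => /eqP Glim; rewrite lte_fin => r0.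
have Gr1 : G r = 1.
  apply/eqP; rewrite eq_le G_le1/=.
  apply: (cvgr_to_ge (@G_rcvg r)).
  near=> t; rewrite leNgt; apply/negP => Gt1.
  have : (t%:E <= t_G G)%E.
    apply: ereal_sup_ubound; exists t => //; split=> //.
    by rewrite (le_trans (ltW r0))// ltW//; near: t; exact: nbhs_right_gt.
  by rewrite E lee_fin leNgt; apply/negP; rewrite negbK; near: t; exact: nbhs_right_gt.
have Gcvg : G x @[x --> r^'-] --> G r.
  rewrite Glim; apply: nondecreasing_at_left_is_cvgr.
    by near=> x => u v _ _; exact: cumulative_is_nondecreasing.
  by near=> x; exists 1 => _ [y _ <-]; exact: G_le1.
apply/eqP; rewrite eq_le measure_ge0 andbT; apply/lee_addgt0Pr => e e0.
rewrite add0e; near r^'- => t.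
have te : 1 - G t <= e.
  by rewrite lerBlDl -lerBlDr; near: t; apply: (cvgr_ge _ Gcvg); rewrite Gr1 gtrBl.
apply: le_trans (_ : dG G `]t, +oo[ <= _)%E; last by rewrite dG_itvoy lee_fin.
apply: le_measure; rewrite ?inE//.
  rewrite (_ : mkset _ = `[r, +oo[%classic)//.
  by apply/seteqP; split => v /=; rewrite in_itv/= andbT lee_fin.
move=> v /=; rewrite in_itv/= andbT lee_fin; apply: lt_le_trans.
by near: t; exact: nbhs_left_lt.
Unshelve. all: by end_near. Qed.

Lemma dG_itvoy_tG s : G 0 = 0 -> jump_tG G = 0 -> 0 <= s ->
  dG G (`]s, +oo[ `&` itv_tG G) = (1 - G s)%:E.
Proof.
move=> G0 jump0 s0; rewrite -dG_itvoy.
have mI : measurable ((`]s, +oo[ `&` itv_tG G) : set (measurableTypeR R)).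
  by apply: measurableI => //; exact: measurable_itv_tG.
apply/eqP; rewrite eq_le; apply/andP; split.
  by apply: le_measure; rewrite ?inE//; exact: subIsetl.
rewrite -[leRHS]adde0 -[X in (_ + X)%E](dG_ge_tG G0 jump0).
apply: le_trans (measureU2 _ _ measurable_ge_tG) => //.
apply: le_measure; rewrite ?inE//.
  by apply: measurableU => //; exact: measurable_ge_tG.
move=> v sv; have [vG|] := ltP v%:E (t_G G); [left|by right].
split=> //; split=> //; apply: le_lt_trans s0 _.
by move: sv; rewrite /= in_itv/= andbT.
Qed.

End distribution_function.

(** * Regularity of a function with a local density *)

Section paths.
Context {R : realType} (G : cumulativeBounded (0 : R) (1 : R)).
Variables F f : R -> R.
Hypothesis hf : local_density G F f.

Lemma density_eq t : 0 <= t -> (t%:E < t_G G)%E ->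
  F t = F 0 + \int[dG G]_(v in `]0, t]) f v.
Proof.
rewrite le_eqVlt => /predU1P[<-|t0] tG.
  by rewrite set_itv_ge ?bnd_simp// Rintegral_set0 addr0.
have [_ /(_ t)] := hf.2 t t0 tG; rewrite t0 lexx => /(_ isT) <-.
by rewrite addrC subrK.
Qed.

(** Along a sequence decreasing to [t], the intervals ]0, u n] shrink to ]0, t].
    They are cut at some [b < t_G], because [f] is integrable only locally. *)
Lemma local_density_right_cvg t : 0 <= t -> (t%:E < t_G G)%E ->
  F x @[x --> t^'+] --> F t.
Proof.
move=> t0 tG; have [b tb bG] := lt_tG_ex tG.
have b0 : 0 < b by exact: le_lt_trans tb.
have [fi _] := hf.2 b b0 bG.
apply/cvg_at_rightP => u [ut /cvgrPdist_lt ucvg].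
have u_lt x : t < x -> \forall n \near \oo, u n < x.
  move=> tx; have := ucvg (x - t); rewrite subr_gt0 => /(_ tx).
  apply: filterS => n; rewrite distrC => /(le_lt_trans (ler_norm _)).
  by rewrite ltrD2r.
have : F 0 + \int[dG G]_(v in `]0, Num.min (u n) b]) f v @[n --> \oo] --> F t.
  rewrite (density_eq t0 tG); apply: cvgD; first exact: cvg_cst.
  apply: (@Rintegral_cvg_set _ _ _ (dG G) `]0, b]%classic f
    (fun n => `]0, Num.min (u n) b]%classic) `]0, t]%classic) => //.
  - by move=> n; apply: subset_itvl; rewrite bnd_simp ge_min lexx orbT.
  - by apply: subset_itvl; rewrite bnd_simp ltW.
  move=> x; rewrite /= in_itv/= => /andP[x0 xb].
  have [xt|tx] := leP x t.
    near=> n; rewrite !mem_set//= in_itv/= x0//= le_min xb andbT.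
    by rewrite (le_trans xt)// ltW.
  near=> n; rewrite !memNset//= in_itv/= x0//= ?le_min ?xb ?andbT; apply/negP;
    rewrite -ltNge//.
  by near: n; exact: u_lt.
apply: cvg_trans; apply: near_eq_cvg; near=> n.
have unb : u n < b by near: n; exact: u_lt.
rewrite min_l ?ltW//= -density_eq//; first by rewrite (le_trans t0)// ltW.
by apply: lt_trans bG; rewrite lte_fin.
Unshelve. all: by end_near. Qed.

(** Here the intervals increase to the open interval ]0, t[: the atom of [dG]
    at [t] makes the difference between [F t] and its left limit. *)
Lemma local_density_left_cvg t : 0 < t -> (t%:E < t_G G)%E ->
  F x @[x --> t^'-] --> F 0 + \int[dG G]_(v in `]0, t[) f v.
Proof.
move=> t0 tG; have [fi _] := hf.2 t t0 tG.
apply/cvg_at_leftP => u [ut /cvgrPdist_lt ucvg].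
have u_gt x : x < t -> \forall n \near \oo, x < u n.
  move=> xt; have := ucvg (t - x); rewrite subr_gt0 => /(_ xt).
  apply: filterS => n /(le_lt_trans (ler_norm _)).
  by rewrite ltrD2l ltrN2.
have : F 0 + \int[dG G]_(v in `]0, u n]) f v @[n --> \oo] --> F 0 + \int[dG G]_(v in `]0, t[) f v.
  apply: cvgD; first exact: cvg_cst.
  apply: (@Rintegral_cvg_set _ _ _ (dG G) `]0, t]%classic f
    (fun n => `]0, u n]%classic) `]0, t[%classic) => //.
  - by move=> n; apply: subset_itvl; rewrite bnd_simp ltW.
  - by apply: subset_itvl; rewrite bnd_simp.
  move=> x; rewrite /= in_itv/= => /andP[x0 xb].
  have [xt|tx] := ltP x t.
    near=> n; rewrite !mem_set//= in_itv/= x0//=.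
    by rewrite ltW//; near: n; exact: u_gt.
  near=> n; rewrite !memNset//= in_itv/= x0//=; apply/negP; rewrite -?leNgt -?ltNge//.
  exact: lt_le_trans tx.
apply: cvg_trans; apply: near_eq_cvg; near=> n.
rewrite -density_eq//.
  by rewrite ltW//; near: n; exact: u_gt.
by apply: lt_trans tG; rewrite lte_fin.
Unshelve. all: by end_near. Qed.

Lemma left_lim_density t : 0 < t -> (t%:E < t_G G)%E ->
  left_lim F t%:E = F 0 + \int[dG G]_(v in `]0, t[) f v.
Proof.
move=> t0 tG; apply: cvg_lim => //; first exact: at_left_proper_filter.
exact: local_density_left_cvg.
Qed.

Lemma left_lim_cvg t : 0 < t -> (t%:E < t_G G)%E ->
  F x @[x --> t^'-] --> left_lim F t%:E.
Proof.
by move=> t0 tG; rewrite left_lim_density//; exact: local_density_left_cvg.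
Qed.

(** [F] up to time [v] is dominated by its total variation, which unlike the
    running supremum of [|F|] is an integral and can be fed to Fubini. *)
Lemma norm_le_variation t v : 0 <= t -> t < v -> (v%:E < t_G G)%E ->
  `|F t| <= `|F 0| + \int[dG G]_(u in `]0, v[) `|f u|.
Proof.
move=> t0 tv vG; have v0 : 0 < v := le_lt_trans t0 tv.
have tG : (t%:E < t_G G)%E by apply: lt_trans vG; rewrite lte_fin.
have [fi _] := hf.2 v v0 vG.
have fiS A : measurable A -> A `<=` `]0, v] -> (dG G).-integrable A (EFin \o f).
  by move=> mA Av; exact: integrableS fi.
rewrite (density_eq t0 tG); apply: (le_trans (ler_normD _ _)); rewrite lerD2l.
have ft : (dG G).-integrable `]0, t] (EFin \o f).
  by apply: fiS => //; apply: subset_itvl; rewrite bnd_simp ltW.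
have fv : (dG G).-integrable `]0, v[ (EFin \o f).
  by apply: fiS => //; apply: subset_itvl; rewrite bnd_simp.
apply: (le_trans (le_normr_Rintegral _ ft)) => //.
apply: fine_le.
- by apply: integrable_fin_num => //; exact: (integrable_abse ft).
- by apply: integrable_fin_num => //; exact: (integrable_abse fv).
apply: ge0_subset_integral => //.
  apply/measurable_EFinP/measurableT_comp => //.
  have /integrableP[/measurable_EFinP + _] := fi; apply: measurable_funS => //.
  by apply: subset_itvl; rewrite bnd_simp.
by apply: subset_itvl; rewrite bnd_simp.
Qed.

Hypothesis mF : measurable_fun (`[0, +oo[ : set R) F.

(** A left limit that exists is a limit along a sequence, here
    [v - v / (n + 2)], which stays in the domain of [F]. *)
Lemma measurable_left_lim : measurable_fun (itv_tG G) (left_lim F \o EFin).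
Proof.
pose r n (v : R) := v - v / n.+2%:R.
apply: (@measurable_fun_cvg _ _ _ _ (fun n => F \o r n)) => [n|v [v0 vG]].
  apply: (measurable_comp _ _ mF) => //.
    move=> _ [v [v0 _] <-]; rewrite /= in_itv/= andbT /r subr_ge0.
    by rewrite ler_pdivrMr// ler_pMr// ler1n.
  by apply: measurable_funB => //; exact: measurable_funM.
have /cvg_at_leftP := left_lim_cvg v0 vG; apply; split=> [n|].
  by rewrite /r gtrBl divr_gt0.
rewrite -[X in _ --> X]subr0 /r; apply: cvgB; first exact: cvg_cst.
rewrite -[X in _ --> X](mulr0 v); apply: cvgM; first exact: cvg_cst.
by rewrite (cvg_shiftS (fun n => n.+1%:R^-1 : R)); exact: cvg_harmonic.
Qed.

Lemma measurable_calA : measurable_fun (itv_tG G) (calA G F f).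
Proof.
apply: (@eq_measurable_fun _ _ _ _ _
  (fun v => (left_lim F \o EFin) v - f v * (1 - G v))).
  by move=> v; rewrite inE /calA => -[_ ->].
apply: measurable_funB; first exact: measurable_left_lim.
apply: measurable_funM.
  apply: measurable_funS hf.1 => //.
  by move=> v [v0 _]; rewrite /= in_itv/= v0.
apply: measurable_funB => //; apply: measurable_funTS.
by apply: nondecreasing_measurable => // x y; exact: cumulative_is_nondecreasing.
Qed.

End paths.

(** * Fubini against the tails of G *)

Section tail_fubini.
Context {R : realType} (G : cumulativeBounded (0 : R) (1 : R)).
Let mu := dG G.
Variable h : measurableTypeR R -> R.
Hypothesis mh : measurable_fun setT h.
Hypothesis hi : mu.-integrable setT (fun u => (h u * (1 - G u))%:E).

(* The first coordinate is the outer variable [v], the second the inner one [u]. *)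
Let k (p : measurableTypeR R * measurableTypeR R) := if (p.2 : R) < p.1 then h p.2 else 0.

Let mk : measurable_fun setT k.
Proof.
apply: measurable_fun_ifT => //.
- exact: (@measurable_fun_ltr _ _ _ setT snd fst).
- exact: measurableT_comp.
Qed.

Let int_k u (g : \bar R -> \bar R) : g 0%E = 0%E ->
  (\int[mu]_v g (k (v, u))%:E = \int[mu]_(v in `]u, +oo[) g (h u)%:E)%E.
Proof.
move=> g0; rewrite [RHS]integral_mkcond; apply: eq_integral => v _.
rewrite /k/= /patch; case: ifPn => uv; first by rewrite mem_set//= in_itv/= uv.
by rewrite memNset//= in_itv/= (negbTE uv).
Qed.

(* Tonelli: integrating [|k|] over [v] first leaves [|h u|] times the tail
   [dG ]u, +oo[ = 1 - G u]. *)
Let integrable_k : (mu \x mu)%E.-integrable setT (EFin \o k).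
Proof.
apply/(integrable21ltyP mu mu); first exact/measurable_EFinP.
rewrite (eq_integral (fun u => `|(h u * (1 - G u))%:E|%E)) => [|u _].
  by case/integrableP : hi.
rewrite (int_k _ (g := abse)) ?abse0// integral_cst//=.
rewrite [X in (_ * X)%E](dG_itvoy G u) -EFinM /= normrM.
by rewrite (@ger0_norm _ (1 - G u))// subr_ge0 G_le1.
Qed.

Let int_primitiveE v : (\int[mu]_u (k (v, u))%:E = \int[mu]_(u in `]-oo, v[) (h u)%:E)%E.
Proof.
rewrite [RHS]integral_mkcond; apply: eq_integral => u _.
rewrite /k/= /patch; case: ifPn => uv; first by rewrite mem_set//= in_itv/= uv.
by rewrite memNset//= in_itv/= (negbTE uv).
Qed.

Lemma integrable_primitive :
  mu.-integrable setT (fun v => \int[mu]_(u in `]-oo, v[) (h u)%:E)%E.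
Proof.
apply: (eq_integrable _ _ _ _ (integrable_fubini_F integrable_k)) => // v _.
by rewrite -int_primitiveE.
Qed.

(** In the double integral, [h u] is counted once for every [v > u], that is with
    weight [dG ]u, +oo[ = 1 - G u]. *)
Lemma integral_primitive :
  (\int[mu]_v \int[mu]_(u in `]-oo, v[) (h u)%:E = \int[mu]_u (h u * (1 - G u))%:E)%E.
Proof.
under eq_integral do rewrite -int_primitiveE.
rewrite (Fubini integrable_k); apply: eq_integral => u _ /=.
by rewrite (int_k _ (g := id))// integral_cst//= [X in (_ * X)%E](dG_itvoy G u).
Qed.

End tail_fubini.

(** * Consequences of integrability *)

Section closed_form.
Context {R : realType} (G : cumulativeBounded (0 : R) (1 : R)).
Variables F f : R -> R.
Hypotheses (G0 : G 0 = 0) (jump0 : jump_tG G = 0) (hf : local_density G F f).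
Hypotheses (iF : L1_dG G (left_lim F \o EFin)) (iA : L1_dG G (calA G F f)).
Let mu := dG G.

Lemma left_lim_increment s v : 0 <= s -> s < v -> (v%:E < t_G G)%E ->
  left_lim F v%:E - F s = \int[dG G]_(u in `]s, v[) f u.
Proof.
move=> s0 sv vG; have v0 : 0 < v := le_lt_trans s0 sv.
have sG : (s%:E < t_G G)%E by apply: lt_trans vG; rewrite lte_fin.
rewrite (left_lim_density hf v0 vG) (density_eq hf s0 sG).
have e : `]0, v[%classic = `]0, s] `|` `]s, v[ :> set R.
  by rewrite -itv_bndbnd_setU// bnd_simp.
rewrite e Rintegral_setU//.
- by rewrite addrA [X in X - _]addrC addrK.
- rewrite -e; have [fi _] := hf.2 v v0 vG; apply: integrableS fi => //.
  by apply: subset_itvl; rewrite bnd_simp.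
- apply/disj_setPS => u [] /=; rewrite !in_itv/= => /andP[_ us] /andP[+ _].
  by rewrite ltNge us.
Qed.

(** Integrability of [F_-] and [calA] thus makes [f * (1 - G)] integrable, although
    [f] itself need not be. *)
Lemma mul_tail_calA v : itv_tG G v -> f v * (1 - G v) = left_lim F v%:E - calA G F f v.
Proof. by move=> [_ vG]; rewrite /calA vG subKr. Qed.

Let integrable_ftail : mu.-integrable (itv_tG G) (fun v => (f v * (1 - G v))%:E).
Proof.
have := integrableB (measurable_itv_tG G) iF iA.
by apply: eq_integrable => //; [exact: measurable_itv_tG|move=> v /set_mem/mul_tail_calA ->].
Qed.

Let mf : measurable_fun (itv_tG G) f.
Proof. by apply: measurable_funS hf.1 => // v [v0 _]; rewrite /= in_itv/= v0. Qed.

Let mh (h : R -> R) (D : set (measurableTypeR R)) : measurable D ->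
  D `<=` itv_tG G -> measurable_fun (itv_tG G) h ->
  measurable_fun (setT : set (measurableTypeR R)) (h \_ D).
Proof.
move=> mD DG mh; apply/(measurable_restrictT h mD).
exact: (measurable_funS (measurable_itv_tG G) DG mh).
Qed.

Let hi (h : R -> R) (D : set (measurableTypeR R)) : measurable D -> D `<=` itv_tG G ->
  measurable_fun (itv_tG G) h -> (forall v, D v -> `|h v| <= `|f v|) ->
  mu.-integrable setT (fun v => ((h \_ D) v * (1 - G v))%:E).
Proof.
move=> mD DG mh' hf'.
have e : (fun v => ((h \_ D) v * (1 - G v))%:E) = (fun v => (h v * (1 - G v))%:E) \_ D.
  by apply/funext => v; rewrite /patch; case: ifP => // _; rewrite mul0r.
rewrite e; apply/(integrable_mkcond _ mD).1.
apply: le_integrable (integrableS (measurable_itv_tG G) mD DG integrable_ftail) => //.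
  apply/measurable_EFinP/measurable_funM.
    exact: (measurable_funS (measurable_itv_tG G) DG mh').
  apply: measurable_funB => //; apply: measurable_funTS.
  by apply: nondecreasing_measurable => // x y; exact: cumulative_is_nondecreasing.
by move=> v Dv; rewrite lee_fin !normrM ler_wpM2r// hf'.
Qed.

Let int_patch (h : R -> R) (D : set R) v :
  (\int[mu]_(u in `]-oo, v[) ((h \_ D) u)%:E = \int[mu]_(u in `]-oo, v[ `&` D) (h u)%:E)%E.
Proof.
rewrite integral_mkcondr; apply: eq_integral => u _.
by rewrite /patch; case: ifP.
Qed.

Let itv_cut s v : 0 <= s -> (v%:E < t_G G)%E ->
  `]-oo, v[ `&` (`]s, +oo[ `&` itv_tG G) = `]s, v[%classic :> set R.
Proof.
move=> s0 vG; apply/seteqP; split => u /=; rewrite !in_itv/= ?andbT.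
  by case=> uv [su _]; rewrite su.
move=> /andP[su uv]; split => //; split => //; split; first exact: le_lt_trans su.
by apply: lt_trans vG; rewrite lte_fin.
Qed.

Lemma integrable_variation : mu.-integrable (itv_tG G)
  (fun v => (\int[dG G]_(u in `]0, v[) `|f u|)%:E).
Proof.
pose D := `]0, +oo[ `&` itv_tG G.
have DE : D = itv_tG G by apply/setIidPr => v [v0 _]; rewrite /= in_itv/= v0.
have mG := measurable_itv_tG G.
have mnf : measurable_fun (itv_tG G) (Num.norm \o f) by exact: measurableT_comp.
have mD : measurable (D : set (measurableTypeR R)) by rewrite DE.
have DG : D `<=` itv_tG G by rewrite DE.
have H : forall v, D v -> `|(Num.norm \o f) v| <= `|f v| by move=> v _ /=; rewrite normr_id.
have ip := integrable_primitive (mh mD DG mnf) (hi mD DG mnf H).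
have := integrableS measurableT mG (@subsetT _ _) ip.
apply: eq_integrable => // v /set_mem[v0 vG].
rewrite int_patch itv_cut// fineK//.
have [fi _] := hf.2 v v0 vG.
apply: integrable_fin_num => //; apply: integrableS (integrable_abse fi) => //.
by apply: subset_itvl; rewrite bnd_simp.
Qed.

(** Integrated form of [d (F * (1 - G)) = - calA dG], with vanishing boundary
    term at [t_G]: since [f * (1 - G)] is integrable up to [t_G], Fubini applies
    on the whole of ]s, t_G[ at once. *)
Lemma calA_tail_integral s : 0 <= s -> (s%:E < t_G G)%E ->
  F s * (1 - G s) = \int[dG G]_(v in `]s, +oo[ `&` itv_tG G) calA G F f v.
Proof.
move=> s0 sG; set D := `]s, +oo[ `&` itv_tG G.
have mG := measurable_itv_tG G.
have mD : measurable (D : set (measurableTypeR R)) by exact: measurableI.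
have DG : D `<=` itv_tG G by move=> v [].
have H : forall v, D v -> `|f v| <= `|f v| by [].
have ip := integrable_primitive (mh mD DG mf) (hi mD DG mf H).
have := integral_primitive (mh mD DG mf) (hi mD DG mf H).
set P := fun v => _ in ip *.
have PD v : D v -> P v = (left_lim F v%:E - F s)%:E.
  move=> [+ [v0 vG]]; rewrite /= in_itv/= andbT => sv.
  rewrite /P int_patch itv_cut// left_lim_increment// fineK//.
  have [fi _] := hf.2 v v0 vG.
  apply: integrable_fin_num => //; apply: integrableS fi => //.
  by apply: subset_itv; rewrite bnd_simp.
(* [P] vanishes up to [s], and ]-oo, t_G[ has full measure. *)
have -> : (\int[mu]_v P v = \int[mu]_(v in D) P v)%E.
  rewrite [RHS]integral_mkcond; apply: ae_eq_integral => //.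
  - by case/integrableP : ip.
  - by apply/(measurable_restrictT P mD); apply: measurable_funTS; case/integrableP : ip.
  exists [set v | (t_G G <= v%:E)%E]; split.
  - exact: measurable_ge_tG.
  - exact: dG_ge_tG.
  move=> v /= /not_implyP[_ PN]; rewrite leNgt; apply/negP => vG; apply: PN.
  rewrite patchE; case: ifPn => // /negP vD.
  rewrite /P int_patch.
  rewrite (_ : _ `&` _ = set0) ?integral_set0//.
  rewrite -subset0 => u [/=]; rewrite in_itv/= => uv [+ [u0 _]].
  rewrite /= in_itv/= andbT => su; apply: vD; rewrite inE; split => /=.
    by rewrite in_itv/= andbT (lt_trans su).
  by split=> //; exact: lt_trans uv.
have -> : (\int[dG G]_u ((f \_ D) u * (1 - G u))%:E = \int[mu]_(u in D) (f u * (1 - G u))%:E)%E.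
  rewrite [RHS]integral_mkcond; apply: eq_integral => u _.
  by rewrite /patch; case: ifP => // _; rewrite mul0r.
have -> : (\int[mu]_(v in D) P v = \int[mu]_(v in D) (left_lim F v%:E - F s)%:E)%E.
  by apply: eq_integral => v /set_mem/PD.
have -> : (\int[dG G]_(u in D) (f u * (1 - G u))%:E =
    \int[mu]_(v in D) (left_lim F v%:E - calA G F f v)%:E)%E.
  by apply: eq_integral => v /set_mem/DG/mul_tail_calA ->.
have iFD := integrableS mG mD DG iF.
have iAD := integrableS mG mD DG iA.
have ic : mu.-integrable D (EFin \o cst (F s)).
  by apply: finite_measure_integrable_cst.
(* Cancelling the integral of [F_-] leaves that of [calA] against the constant
   [F s] times the mass of [D]. *)
move=> /(congr1 fine) E.
have : \int[mu]_(v in D) (left_lim F v%:E - F s) =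
    \int[mu]_(v in D) (left_lim F v%:E - calA G F f v) by [].
rewrite !RintegralB// Rintegral_cst// => /addrI/oppr_inj <-; congr (_ * _).
by rewrite [X in fine X](dG_itvoy_tG G0 jump0 s0).
Qed.

End closed_form.

(** * The law of gamma *)

Section law.
Context {R : realType} {d : measure_display} {Omega : measurableType d}.
Variables (P : probability Omega R) (G : cumulativeBounded (0 : R) (1 : R)).
Variable gamma : {RV P >-> R}.
Hypothesis gammaG : forall t : R, cdf gamma t = (G t)%:E.

(* Lebesgue-Stieltjes measures live on [measurableTypeR R], whose display differs
   from the one of [R] as a measurable type; hence this retyped copy of [gamma]. *)
Let gT : Omega -> measurableTypeR R := gamma.

Let mgT : measurable_fun setT gT.
Proof. exact: (measurable_funPT gamma). Qed.

#[local] HB.instance Definition _ := @isMeasurableFun.Build _ _ _ _ gT mgT.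

Lemma measure_itvoc (mu : {finite_measure set (measurableTypeR R) -> \bar R}) (a b : R) :
  a <= b -> (mu `]a, b]%classic = mu `]-oo, b]%classic - mu `]-oo, a]%classic)%E.
Proof.
move=> ab; have -> : `]a, b]%classic = `]-oo, b] `\` `]-oo, a] :> set R.
  by rewrite -[RHS]setCK setCD setCitvl setUC -[LHS]setCK setCitv.
rewrite measureD ?setIidr//; first exact: subset_itvl.
by rewrite -ge0_fin_numE// fin_num_measure.
Qed.

(** Both measures give ]a, b] the mass [G b - G a], and such intervals generate
    the Borel sets. *)
Lemma dG_law (A : set (measurableTypeR R)) : measurable A -> dG G A = P (gamma @^-1` A).
Proof.
have := @lebesgue_stieltjes_measure_unique R G (distribution P gT); apply.
move=> _ [[a b] _ <-] /=.
have [ab|ba] := leP a b; last by rewrite set_itv_ge ?measure0// bnd_simp -leNgt ltW.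
rewrite [RHS](@measure_itvoc (distribution P gT) a b ab).
rewrite [LHS](@measure_itvoc (lebesgue_stieltjes_measure G) a b ab).
congr (_ - _)%E; rewrite [LHS]dG_itvNyc -gammaG//.
Qed.

Lemma ge0_integral_law (D : set (measurableTypeR R)) (h : R -> \bar R) : measurable D ->
  measurable_fun D h -> (forall v, D v -> 0 <= h v)%E ->
  (\int[P]_(w in gamma @^-1` D) h (gamma w) = \int[dG G]_(v in D) h v)%E.
Proof.
move=> mD mh h0.
rewrite (eq_measure_integral (distribution P gT)); last by move=> A mA _; exact: dG_law.
rewrite [RHS](@ge0_integral_pushforward _ _ _ _ _ gT mgT)//.
by move=> v /set_mem/h0.
Qed.

Lemma integrable_law (D : set (measurableTypeR R)) (h : R -> R) : measurable D ->
  measurable_fun D h ->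
  P.-integrable (gamma @^-1` D) (EFin \o h \o gamma) <-> (dG G).-integrable D (EFin \o h).
Proof.
move=> mD mh.
have E : (\int[P]_(w in gamma @^-1` D) `|(h (gamma w))%:E| = \int[dG G]_(v in D) `|(h v)%:E|)%E.
  rewrite (ge0_integral_law (h := fun v => `|(h v)%:E|%E))//.
  exact/measurable_EFinP/measurableT_comp.
split=> /integrableP[_]; [rewrite E|rewrite -E] => ilt; apply/integrableP; split=> //.
  exact/measurable_EFinP.
apply/measurable_EFinP; apply: (measurable_comp mD _ mh) => //; first by move=> _ [w + <-].
exact: measurable_funTS mgT.
Qed.

Lemma Rintegral_law (D : set (measurableTypeR R)) (h : R -> R) : measurable D ->
  (dG G).-integrable D (EFin \o h) ->
  \int[P]_(w in gamma @^-1` D) h (gamma w) = \int[dG G]_(v in D) h v.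
Proof.
move=> mD ih; have mh : measurable_fun D h by apply/measurable_EFinP; case/integrableP: ih.
congr fine; rewrite integralE [RHS]integralE.
have mhE : measurable_fun D (EFin \o h) by exact/measurable_EFinP.
rewrite -(ge0_integral_law (h := (EFin \o h)^\+%E))//; last exact: measurable_funepos.
rewrite -(ge0_integral_law (h := (EFin \o h)^\-%E))//; last exact: measurable_funeneg.
by congr (_ - _)%E; apply: eq_integral => w _; rewrite ?funeposE ?funenegE.
Qed.

End law.

(** * The natural filtration of gamma *)

Section filtration_gamma.
Context {R : realType} {d : measure_display} {Omega : measurableType d}.
Variable gamma : Omega -> R.
Hypothesis mgamma : measurable_fun setT gamma.
Hypothesis gamma_gt0 : forall w, 0 < gamma w.
Notation FF := (filtration_gamma gamma).

Lemma filtration_gammaP : filtration FF.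
Proof.
split=> [t _|t t0|s t s0 st].
- exact: smallest_sigma_algebra.
- apply: smallest_sub; first exact: sigma_algebra_measurable.
  move=> _ [s _ ->]; rewrite -[mkset _]setTI.
  apply: (@emeasurable_fun_infty_c _ _ _ setT (EFin \o gamma)) => //.
  exact/measurable_EFinP.
- apply: sub_sigma_algebra2 => A [u /andP[u0 us] ->].
  by exists u => //; rewrite u0 (le_trans us).
Qed.

(** Before [gamma] nothing has been observed: the generators are disjoint from
    [{t < gamma}], and the sets that contain or avoid it form a sigma-algebra. *)
Lemma filtration_gamma_atom t A : FF t A ->
  A `&` [set w | (t < (gamma w)%:E)%E] = set0 \/ [set w | (t < (gamma w)%:E)%E] `<=` A.
Proof.
set B := mkset _.
have H : FF t `<=` [set A | A `&` B = set0 \/ B `<=` A].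
  apply: smallest_sub.
    split=> [|D|D HD].
    - by left; rewrite set0I.
    - rewrite setTD => -[DB|BD]; [right|left].
      + by move=> w Bw Dw; have : (D `&` B) w by []; rewrite DB.
      + by rewrite -subset0 => w [nDw /BD].
    - have [[n BDn]|nBD] := pselect (exists n, B `<=` D n).
        by right => w /BDn ?; exists n.
      left; rewrite -subset0 => w [[n _ Dnw] Bw].
      have [DB|BD] := HD n; last by apply: nBD; exists n.
      by have : (D n `&` B) w by []; rewrite DB.
  move=> _ [s /andP[_ st] ->]; left; rewrite -subset0 => w [/= gs].
  by rewrite /B/= ltNge (le_trans gs st).
exact: H.
Qed.

(** Once [gamma] has occurred, its exact value is known. *)
Lemma filtration_gamma_cut t (B : set R) : (0 <= t)%E -> measurable B ->
  FF t ([set w | ((gamma w)%:E <= t)%E] `&` gamma @^-1` B).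
Proof.
move=> t0 mB; have [F0 FC FU] : sigma_algebra setT (FF t) := smallest_sigma_algebra _ _.
have F_le u : (u <= t)%E -> FF t [set w | ((gamma w)%:E <= u)%E].
  move=> ut; have [u0|u0] := leP u 0%E.
    rewrite (_ : mkset _ = set0)// -subset0 => w /= /le_trans/(_ u0).
    by rewrite lee_fin leNgt gamma_gt0.
  by apply: sub_sigma_algebra; exists u => //; rewrite u0.
have FD A C : FF t A -> FF t C -> FF t (A `\` C).
  move=> FA FB; rewrite (_ : A `\` C = setT `\` \bigcup_k (bigcup2 (setT `\` A) C k)).
    by apply: (FC); apply: (FU) => -[|[|?]] //=; apply: (FC).
  by rewrite bigcup2E !setTD setCU setCK.
suff : measurable `<=` [set C | FF t ([set w | ((gamma w)%:E <= t)%E] `&` gamma @^-1` C)] by exact.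
rewrite /measurable/= /measurableR RGenOInfty.measurableE.
apply: smallest_sub.
  split=> /= [|A FA|A FA].
  - by rewrite preimage_set0 setI0.
  - rewrite setTD preimage_setC -setDE.
    rewrite -[X in FF t X]set0U -(setDv [set w | ((gamma w)%:E <= t)%E]) -setDIr.
    exact: FD (F_le _ (lexx t)) FA.
  - by rewrite preimage_bigcup setI_bigcupr; exact: FU.
move=> _ [x ->] /=.
rewrite (_ : _ `&` _ = [set w | ((gamma w)%:E <= t)%E] `\`
    [set w | ((gamma w)%:E <= Order.min x%:E t)%E]).
  by apply: FD; apply: F_le => //; rewrite ge_min lexx orbT.
apply/seteqP; split => w /=; rewrite in_itv/= andbT le_min lee_fin.
  by move=> [gt xg]; split=> //; rewrite gt andbT; apply/negP; rewrite -ltNge.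
by move=> [gt /negP]; rewrite gt andbT -ltNge.
Qed.

(** Adaptedness of processes such as [calM]: deterministic before [gamma], frozen
    at a function of [gamma] afterwards. *)
Lemma measurable_wrt_stopped (c : R) (Y : R -> R) t : (0 <= t)%E ->
  measurable_fun setT Y ->
  measurable_wrt (FF t) (fun w => if (t < (gamma w)%:E)%E then c else Y (gamma w)).
Proof.
move=> t0 mY B mB.
have mYB : measurable (Y @^-1` B) by rewrite -[X in measurable X]setTI; exact: mY.
have [F0 FC FU] : sigma_algebra setT (FF t) := smallest_sigma_algebra _ _.
have Fcut := filtration_gamma_cut t0 mYB.
have Fgt : FF t [set w | (t < (gamma w)%:E)%E].
  have := FC _ (filtration_gamma_cut t0 measurableT); rewrite preimage_setT setIT setTD.
  by congr (FF t _); apply/seteqP; split => w /=; rewrite ltNge => /negP.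
have [cB|cB] := pselect (B c).
  rewrite (_ : _ @^-1` B = \bigcup_k (bigcup2 [set w | (t < (gamma w)%:E)%E]
      ([set w | ((gamma w)%:E <= t)%E] `&` gamma @^-1` (Y @^-1` B)) k)).
    by apply: FU => -[|[|?]].
  rewrite bigcup2E; apply/seteqP; split => w /=.
    by case: ltP => tg; [left|right].
  by case; [move=> ->|case=> gt; rewrite ltNge gt].
rewrite (_ : _ @^-1` B = [set w | ((gamma w)%:E <= t)%E] `&` gamma @^-1` (Y @^-1` B))//.
apply/seteqP; split => w /=; first by case: ltP.
by case=> gt; rewrite ltNge gt.
Qed.

End filtration_gamma.

(** * The process M and the equivalence *)

Section main.
Context {R : realType} {d : measure_display} {Omega : measurableType d}.
Variables (P : probability Omega R) (G : cumulativeBounded (0 : R) (1 : R)).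
Hypothesis G0 : G 0 = 0.
Variable gamma : {RV P >-> R}.
Hypothesis gamma_gt0 : forall w, 0 < gamma w.
Hypothesis gammaG : forall t : R, cdf gamma t = (G t)%:E.
Variables F f : R -> R.
Hypotheses (mF : measurable_fun (`[0, +oo[ : set R) F) (hf : local_density G F f).
Hypothesis jump0 : jump_tG G = 0.

(* Extending [calA] by 0 outside ]0, t_G[ changes nothing at [gamma], but gives a
   function that is Borel on the whole line. *)
Let A := calA G F f \_ (itv_tG G).
Let W := gamma @^-1` itv_tG G.
Let mG := measurable_itv_tG G.
Let mgamma : measurable_fun setT gamma := measurable_funPT gamma.

Let mW : measurable W.
Proof. by rewrite -[X in measurable X]setTI; exact: mgamma. Qed.

Let PWC : P (~` W) = 0%E.
Proof.
rewrite -(dG_ge_tG G0 jump0) (dG_law gammaG) //; last exact: measurable_ge_tG.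
congr (P _); apply/seteqP; split => w /=.
  by rewrite leNgt => nW; apply/negP => gG; apply: nW; split.
by rewrite leNgt => /negP nW [].
Qed.

Lemma calA_ge_tG v : ~ (v%:E < t_G G)%E -> calA G F f v = 0.
Proof. by move=> /negP/negbTE vG; rewrite /calA vG jump0 ltxx mulr0; case: ifP. Qed.

Let AE v : 0 < v -> A v = calA G F f v.
Proof.
move=> v0; rewrite /A patchE; case: ifPn => // /negP vG.
by rewrite calA_ge_tG// => vG'; apply: vG; rewrite inE.
Qed.

Let mA : measurable_fun setT A.
Proof. by apply/(measurable_restrictT _ mG); exact: (measurable_calA hf mF). Qed.

Let calME t w : calM G F f gamma t w = if (t < (gamma w)%:E)%E then F (fine t) else A (gamma w).
Proof. by rewrite /calM AE. Qed.

(** Neighbourhoods of a finite time in the extended line are those of the real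
    line, so one-sided limits may be taken over real times. *)
Lemma cvg_ereal_right (g : \bar R -> R) (s l : R) :
  g x%:E @[x --> s^'+] --> l ->
  g x @[x --> within [set x | (s%:E < x)%E] (nbhs s%:E)] --> l.
Proof. by move=> gl U /gl. Qed.

Lemma cvg_ereal_left (g : \bar R -> R) (s l : R) :
  g x%:E @[x --> s^'-] --> l ->
  g x @[x --> within [set x | (x < s%:E)%E] (nbhs s%:E)] --> l.
Proof. by move=> gl U /gl. Qed.

(** Up to [gamma] the path follows [F], which is cadlag on [0, t_G[, and from
    [gamma < t_G] on it is constant; in particular it has a left limit at [t_G]. *)
Lemma calM_cadlag w : W w -> cadlag_on (t_G G) (calM G F f gamma ^~ w).
Proof.
move=> [_ gG].
have cvg_after (t : \bar R) (D : set (\bar R)) : ((gamma w)%:E < t)%E ->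
    calM G F f gamma x w @[x --> within D (nbhs t)] --> calM G F f gamma t w.
  move=> gt; apply: cvg_near_cst; rewrite near_withinE.
  have : \forall x \near t, ((gamma w)%:E < x)%E.
    exact: (open_nbhs_nbhs (conj (@open_ereal_gt_ereal _ _) gt)).
  by apply: filterS => x gx _; rewrite /calM !ltNge (ltW gx) (ltW gt).
split=> [[t| |]//|[t| |]//].
- rewrite lee_fin => t0 tG; apply: (@cvg_ereal_right (fun x => calM G F f gamma x w)).
  have [tg|gt] := ltP t (gamma w).
    rewrite /calM lte_fin tg /=.
    apply: cvg_trans (local_density_right_cvg hf t0 tG).
    apply: near_eq_cvg; near=> x.
    by rewrite lte_fin (_ : x < gamma w)//; near: x; exact: nbhs_right_lt.
  apply: cvg_near_cst; near=> x.
  rewrite /calM !lte_fin !ltNge gt/= (_ : gamma w <= x)//=.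
  by apply: (le_trans gt); rewrite ltW.
- by move=> _; rewrite ltNge leey.
- rewrite lte_fin => t0 tG; have [tg|gt] := leP t (gamma w).
    apply/cvg_ex; exists (left_lim F t%:E).
    apply: (@cvg_ereal_left (fun x => calM G F f gamma x w)).
    apply: cvg_trans (left_lim_cvg hf t0 (le_lt_trans (_ : t%:E <= _)%E gG)) => //.
    apply: near_eq_cvg; near=> x.
    by rewrite /calM lte_fin (_ : x < gamma w)//; apply: lt_le_trans tg.
  by apply/cvg_ex; eexists; apply: cvg_after.
- by move=> _ _; apply/cvg_ex; eexists; apply: cvg_after; rewrite ltry.
Unshelve. all: by end_near. Qed.

(** [F_- gamma] is a limit of values of [M], hence bounded by the supremum of the
    path, and [M t_G = calA gamma] on [{gamma < t_G}]. *)
Lemma H1_integrable FF : H1_martingale_on P (t_G G) FF (calM G F f gamma) ->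
  L1_dG G (left_lim F \o EFin) /\ L1_dG G (calA G F f).
Proof.
have tG0 := tG_gt0 G0.
move=> [[_ _ iM _] isup].
split; last first.
  apply/(integrable_law gammaG mG (measurable_calA hf mF)).
  have := integrableS measurableT mW (@subsetT _ _) (iM (t_G G) (ltW tG0) (lexx _)).
  by apply: eq_integrable => // w /set_mem[_ gG]; rewrite /calM /= ltNge (ltW gG).
have ml := measurable_left_lim hf mF.
apply/integrableP; split; first exact/measurable_EFinP.
rewrite -(ge0_integral_law gammaG mG (h := fun v => `|(left_lim F v%:E)%:E|%E))//; last first.
  by apply/measurable_EFinP/measurableT_comp.
rewrite integral_mkcond; apply: le_lt_trans isup.
apply: ge0_le_integralT => w.
  by rewrite patchE; case: ifP.
set S := ereal_sup _.
have sup_ge t : (0 <= t)%E -> (t <= t_G G)%E -> (`|calM G F f gamma t w|%:E <= S)%E.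
  by move=> t0 tG; apply: ereal_sup_ubound; exists t => //=; rewrite t0 tG.
have sup_ge0 : (0 <= S)%E by apply: le_trans (sup_ge 0%E (lexx _) (ltW tG0)); rewrite lee_fin.
rewrite patchE; case: ifPn => [/set_mem[_ gG]|_]; last exact: sup_ge0.
move: sup_ge sup_ge0; case: S => [s||]; last 2 first.
- by move=> _ _; rewrite leey.
- by [].
move=> sup_ge _; rewrite lee_fin.
apply: (cvgr_to_le (cvg_norm (left_lim_cvg hf (gamma_gt0 w) gG))).
near=> x.
have xg : x < gamma w by [].
have x0 : 0 <= x by near: x; exact: nbhs_left_ge.
have := sup_ge x%:E; rewrite !lee_fin /calM lte_fin xg; apply => //.
by apply/ltW; apply: lt_trans gG; rewrite lte_fin.
Unshelve. all: by end_near. Qed.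

Section converse.
Hypotheses (iF : L1_dG G (left_lim F \o EFin)) (iA : L1_dG G (calA G F f)).
Notation M := (calM G F f gamma).
Notation FF := (filtration_gamma gamma).

Let AWE w : A (gamma w) = ((calA G F f \o gamma) \_ W) w.
Proof. by []. Qed.

Lemma integrable_Agamma : P.-integrable setT (EFin \o A \o gamma).
Proof.
have /(integrable_law gammaG mG (measurable_calA hf mF)) := iA.
move=> /(integrable_mkcond _ mW); apply: eq_integrable => // w _.
by rewrite /= AWE !patchE; case: ifP.
Qed.

Let measurable_stopped t : measurable [set w | (t < (gamma w)%:E)%E].
Proof.
rewrite -[mkset _]setTI; apply: emeasurable_fun_o_infty => //.
exact/measurable_EFinP.
Qed.

Let FF_sub t : (0 <= t)%E -> FF t `<=` measurable.
Proof. by case: (filtration_gammaP mgamma) => _ + _; apply. Qed.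

Lemma calM_adapted t : (0 <= t)%E -> measurable_wrt (FF t) (M t).
Proof.
move=> t0; rewrite (_ : M t = fun w => if (t < (gamma w)%:E)%E then F (fine t) else A (gamma w)).
  exact: measurable_wrt_stopped.
by apply/funext => w; exact: calME.
Qed.

Let calM_measurable t : (0 <= t)%E -> measurable_fun setT (M t).
Proof.
move=> t0 _ B mB; rewrite setTI.
exact: FF_sub t0 _ (calM_adapted t0 mB).
Qed.

Lemma calM_integrable t : (0 <= t)%E -> P.-integrable setT (EFin \o M t).
Proof.
move=> t0; have ic : P.-integrable setT (EFin \o cst `|F (fine t)|).
  by apply: finite_measure_integrable_cst.
have iAg := integrable_abse integrable_Agamma.
apply: le_integrable (integrableD measurableT ic iAg) => //.
  by apply/measurable_EFinP; exact: calM_measurable.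
move=> w _ /=; rewrite lee_fin calME.
rewrite [leRHS]ger0_norm ?addr_ge0//.
by case: ifP; rewrite ?lerDl ?lerDr.
Qed.

(** For [t < t_G] this is [calA_tail_integral] transported by [gamma]; at [t_G]
    both sides vanish because [{t_G < gamma}] is negligible. *)
Lemma calM_terminal_tail t : (0 <= t)%E -> (t <= t_G G)%E ->
  \int[P]_(w in [set w | (t < (gamma w)%:E)%E]) M t w =
  \int[P]_(w in [set w | (t < (gamma w)%:E)%E]) A (gamma w).
Proof.
move=> t0; set B := mkset _.
have -> : \int[P]_(w in B) M t w = F (fine t) * fine (P B).
  rewrite -(Rintegral_cst P (measurable_stopped t)); apply: eq_Rintegral => w /set_mem tg.
  by rewrite calME tg.
rewrite le_eqVlt => /predU1P[tE|].
  have BW : B `<=` ~` W by move=> w /=; rewrite /B/= tE => gG [_]; rewrite ltNge (ltW gG).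
  rewrite (_ : P B = 0%E) ?mulr0; last first.
    exact: (subset_measure0 (measurable_stopped t) (measurableC mW) BW PWC).
  rewrite /Rintegral integral0_eq//= => w /BW Ww.
  by rewrite AWE patchE memNset.
case: t t0 @B => [s| |]// + B; last by move=> _; rewrite ltNge leey.
rewrite lee_fin => s0 sG /=.
have -> : P B = (1 - G s)%:E.
  rewrite -dG_itvoy (dG_law gammaG)//; congr (P _).
  by apply/seteqP; split => w /=; rewrite /B/= in_itv/= andbT lte_fin.
rewrite /= (calA_tail_integral G0 jump0 hf iF iA s0 sG).
have mD : measurable ((`]s, +oo[ `&` itv_tG G) : set (measurableTypeR R)).
  by apply: measurableI.
rewrite -(Rintegral_law gammaG mD); last by apply: integrableS iA => //; exact: mG.
rewrite Rintegral_mkcond [RHS]Rintegral_mkcond; apply: eq_Rintegral => w _.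
rewrite /A !patchE /B; case: (ltP s (gamma w)) => [sg|gs].
  rewrite [in RHS]mem_set//= ?lte_fin//.
  have [Ww|nWw] := pselect (itv_tG G (gamma w)).
    by rewrite !mem_set//; split => //=; rewrite in_itv/= sg.
  by rewrite !memNset// => -[].
rewrite !memNset//= ?lte_fin; first by apply/negP; rewrite -leNgt.
by rewrite in_itv/= andbT => -[+ _]; rewrite ltNge gs.
Qed.

(** A set of the filtration either avoids [{t < gamma}], where [M t] is already
    [A gamma], or contains all of it, and then [calM_terminal_tail] applies. *)
Lemma calM_closed t B : (0 <= t)%E -> (t <= t_G G)%E -> FF t B ->
  \int[P]_(w in B) M t w = \int[P]_(w in B) A (gamma w).
Proof.
move=> t0 tG FB; set Z := [set w | (t < (gamma w)%:E)%E].
have mB : measurable B by exact: FF_sub t0 _ FB.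
have mZ : measurable Z by exact: measurable_stopped.
have before C : C `&` Z = set0 -> {in C, M t =1 A \o gamma}.
  move=> CZ w /set_mem Cw; rewrite calME; case: ifPn => // tg.
  by have : (C `&` Z) w by []; rewrite CZ.
have [BZ|ZB] := filtration_gamma_atom FB; first exact/eq_Rintegral/before.
have BE : B = (B `\` Z) `|` Z by rewrite setUC setDUK.
have mBZ : measurable (B `\` Z) by exact: measurableD.
have dis : [disjoint B `\` Z & Z] by apply/disj_setPS => w [[]].
rewrite BE !Rintegral_setU//; last 2 first.
- by rewrite -BE; apply: integrableS integrable_Agamma.
- by rewrite -BE; apply: integrableS (calM_integrable t0).
rewrite calM_terminal_tail//; congr (_ + _); apply/eq_Rintegral/before.
by rewrite setDE -setIA setICl setI0.
Qed.

(** The martingale property follows from [calM_closed] at both times.  The path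
    supremum is bounded by an integrable function of [gamma] on [{gamma < t_G}];
    elsewhere it may be infinite, so the majorant is set to +oo there. *)
Lemma H1_of_integrable : H1_martingale_on P (t_G G) FF M.
Proof.
split.
  split.
  - exists (~` W); split; [exact: measurableC|exact: PWC|].
    by move=> w /= nc Ww; apply/nc/calM_cadlag.
  - by move=> t t0 _; exact: calM_adapted.
  - by move=> t t0 _; exact: calM_integrable.
  - move=> s t s0 st tG; exists (M s); last exact: aeW.
    split; [exact: calM_adapted|exact: calM_integrable|move=> B FB].
    rewrite (calM_closed (le_trans s0 st) tG) ?(calM_closed s0 (le_trans st tG))//.
    by case: (filtration_gammaP mgamma) => _ _ +; apply; [exact: s0|exact: st|].
pose K v := `|F 0| + \int[dG G]_(u in `]0, v[) `|f u| + `|calA G F f v|.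
have K_ge0 v : 0 <= K v.
  by rewrite !addr_ge0//; apply: Rintegral_ge0.
have iV := integrable_variation hf iF iA.
have iK : (dG G).-integrable (itv_tG G) (EFin \o K).
  have ic : (dG G).-integrable (itv_tG G) (EFin \o cst `|F 0|).
    by apply: finite_measure_integrable_cst.
  exact: (integrableD mG (integrableD mG ic iV) (integrable_abse iA)).
have mK : measurable_fun (itv_tG G) K by apply/measurable_EFinP; case/integrableP : iK.
have /integrableP[mKg iKg] := (integrable_law gammaG mG mK).2 iK.
pose H w := if w \in W then (K (gamma w))%:E else +oo%E.
have mH : measurable_fun setT H.
  rewrite -(setUv W); apply/measurable_funU => //; first exact: measurableC.
  split.
    by apply: eq_measurable_fun mKg => w wW; rewrite /H wW.
  apply: (@eq_measurable_fun _ _ _ _ _ (cst +oo%E)) => //.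
  by move=> w /set_mem Ww; rewrite /H memNset.
have H0 w : (0 <= H w)%E by rewrite /H; case: ifP => //; rewrite lee_fin.
apply: (@le_lt_trans _ _ (\int[P]_w H w)%E).
  apply: ge0_le_integralT => w.
    apply: le_trans (_ : `|M 0%E w|%:E <= _)%E; first by rewrite lee_fin.
    by apply: ereal_sup_ubound; exists 0%E => //=; rewrite lexx/= ltW// tG_gt0.
  apply: ge_ereal_sup => _ [t /= /andP[t0 tG] <-].
  rewrite /H; case: ifPn => [/set_mem[_ gG]|_]; last by rewrite leey.
  rewrite lee_fin /calM; case: ifPn => [|_]; last first.
    by rewrite /K lerDr addr_ge0//; apply: Rintegral_ge0.
  case: t t0 tG => [s| |]//.
  rewrite lee_fin lte_fin => s0 _ sg /=.
  apply: (le_trans (norm_le_variation hf s0 sg gG)).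
  by rewrite /K lerDl.
rewrite -(setUv W) ge0_integral_setU//; last 3 first.
- exact: measurableC.
- by rewrite setUv.
- by apply/disj_setPS => w [].
rewrite [X in (_ + X)%E]null_set_integral ?adde0; last 3 first.
- exact: measurableC.
- exact: measurable_funTS.
- exact: PWC.
apply: le_lt_trans iKg; rewrite le_eqVlt; apply/orP; left; apply/eqP.
by apply: eq_integral => w wW; rewrite /H wW /= ger0_norm.
Qed.

End converse.

End main.

Theorem lemma3p9 (R : realType) (d : measure_display) (Omega : measurableType d)
    (P : probability Omega R)
    (G : cumulativeBounded (0 : R) (1 : R)) (hG0 : G 0 = 0)
    (gamma : {RV P >-> R}) (hgamma_pos : forall w, 0 < gamma w)
    (hgammaG : forall t : R, cdf gamma t = (G t)%:E)
    (F f : R -> R) (hF : loc_abs_cont G F) (hf : local_density G F f)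
    (hjump : jump_tG G = 0) :
  [<-> exists FF : \bar R -> set (set Omega),
         filtration FF /\ H1_martingale_on P (t_G G) FF (calM G F f gamma);
       H1_martingale_on P (t_G G) (filtration_gamma gamma) (calM G F f gamma);
       L1_dG G (left_lim F \o EFin) /\ L1_dG G (calA G F f)].
Proof.
have mF := hF.1.
have a_c FF : H1_martingale_on P (t_G G) FF (calM G F f gamma) ->
    L1_dG G (left_lim F \o EFin) /\ L1_dG G (calA G F f).
  exact: H1_integrable.
have c_b : L1_dG G (left_lim F \o EFin) /\ L1_dG G (calA G F f) ->
    H1_martingale_on P (t_G G) (filtration_gamma gamma) (calM G F f gamma).
  by move=> [iF iA]; exact: H1_of_integrable.
tfae.
- by move=> [FF [_ /a_c/c_b]].
- exact: a_c.
- move=> /c_b b; exists (filtration_gamma gamma); split=> //.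
  exact: filtration_gammaP (measurable_funPT gamma).
Qed.
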